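(* Let $t$ be a positive integer. Then there exists a positive integer $K(t)$ such that if a graph $G$ satisfies the following conditions: (i) $d(x)>K(t)$ holds for all $x\in V(G)$; (ii) for all $x\in V(G)$, any $(t^2+1)$-plex of $G$ containing $x$ has order at most $\frac{d(x)-K(t)}{t}$; (iii) $\lambda_{\min}(G)\ge -t-1$; then $G$ is the intersection graph of some linear $(t+1)$-uniform hypergraph.
   Context: All graphs are finite, undirected and simple. $d(x)$ is the degree of $x$ in $G$, and $\lambda_{\min}(G)$ is the smallest eigenvalue of the adjacency matrix of $G$. For a positive integer $p$, a $p$-plex of $G$ is an induced subgraph in which each vertex is adjacent to all but at most $p-1$ of the other vertices of that subgraph; its order is its number of vertices. A hypergraph $H$ is a pair $(X,E)$ with $X$ a finite set (vertices) and $E$ a set of non-empty subsets of $X$ (edges). It is $h$-uniform ($h\ge 2$) if every edge has cardinality $h$; it is linear if every pair of distinct vertices is contained in at most one edge. The intersection graph of $H=(X,E)$ is the graph with vertex set $E$ in which two distinct edges $e,e'\in E$ are adjacent iff $e\cap e'\ne\emptyset$. Graphs are identified up to isomorphism. *)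

(* Defs.v *)
From HB Require Import structures.
From mathcomp Require Import all_boot all_order all_algebra.
From mathcomp Require Import polyrcf reals.
Set Implicit Arguments.
Unset Strict Implicit.
Unset Printing Implicit Defensive.
Import Order.TTheory GRing.Theory Num.Theory.
Local Open Scope ring_scope.

Record sgraph := SGraph {
  vertex :> finType;
  adj : rel vertex;
  adj_sym : symmetric adj;
  adj_irrefl : irreflexive adj }.

Definition degree (G : sgraph) (x : G) : nat := #|[set y | adj x y]|.

Definition adjmx (R : nzRingType) (G : sgraph) : 'M[R]_#|G| :=
  \matrix_(i, j) (adj (enum_val i) (enum_val j))%:R.

(* [rootsR] lists the roots in increasing order; the value is 0 when [A] has no
   eigenvalue in [R], which for an adjacency matrix only happens when it is
   0 x 0 (a real symmetric matrix of positive size has a real eigenvalue). *)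
Definition min_eigenvalue (R : rcfType) n (A : 'M[R]_n) : R :=
  head 0 (rootsR (char_poly A)).

Lemma min_eigenvalueP (R : rcfType) n (A : 'M[R]_n) (a : R) :
  eigenvalue A a ->
  eigenvalue A (min_eigenvalue A) /\ min_eigenvalue A <= a.
Proof.
have chi0 : char_poly A != 0 by rewrite monic_neq0 ?char_poly_monic.
have inE x : (x \in rootsR (char_poly A)) = eigenvalue A x.
  have := roots_on_rootsR chi0 x; rewrite !inE eigenvalue_root_char /=.
  by move=> <-.
rewrite -!inE /min_eigenvalue.
have : sorted <%R (rootsR (char_poly A)) by exact: sorted_roots.
case: (rootsR _) => // x s /= xs; rewrite !in_cons eqxx /= => /orP ax.
split=> //; case: ax => [/eqP -> // | sa].
by move/(order_path_min lt_trans)/allP/(_ _ sa)/ltW: xs.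
Qed.

Definition lambda_min (R : rcfType) (G : sgraph) : R :=
  min_eigenvalue (adjmx R G).

(* [S] is the vertex set of the induced subgraph, so the order of the plex
   is [#|S|]. *)
Definition plex (p : nat) (G : sgraph) (S : {set G}) : Prop :=
  forall x, x \in S -> (#|[set y in S | (y != x) && ~~ adj x y]| <= p - 1)%N.

Record hypergraph := Hypergraph {
  hvertex : finType;
  hedges : {set {set hvertex}};
  hedges_nonempty : set0 \notin hedges }.

Definition uniform (h : nat) (H : hypergraph) : Prop :=
  forall e, e \in hedges H -> #|e| = h.

Definition linear_hypergraph (H : hypergraph) : Prop :=
  forall x y : hvertex H, x != y ->
    (#|[set e in hedges H | (x \in e) && (y \in e)]| <= 1)%N.

Definition hedge (H : hypergraph) : finType :=
  {e : {set hvertex H} | e \in hedges H}.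

Definition iadj (H : hypergraph) : rel (hedge H) :=
  fun e f => (e != f) && (val e :&: val f != set0).

Lemma iadj_sym H : symmetric (@iadj H).
Proof. by move=> e f; rewrite /iadj eq_sym setIC. Qed.

Lemma iadj_irrefl H : irreflexive (@iadj H).
Proof. by move=> e; rewrite /iadj eqxx. Qed.

Definition intersection_graph (H : hypergraph) : sgraph :=
  SGraph (@iadj_sym H) (@iadj_irrefl H).

Definition isomorphic (G1 G2 : sgraph) : Prop :=
  exists2 f : G1 -> G2, bijective f & {mono f : x y / adj x y}.

(* Main.v *)
Require Import Defs.
From mathcomp Require Import all_boot all_order all_algebra.
From mathcomp Require Import ring lra.
From mathcomp Require Import complex spectral reals.
Set Implicit Arguments.
Unset Strict Implicit.
Unset Printing Implicit Defensive.
Import Order.TTheory GRing.Theory Num.Theory.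
Local Open Scope ring_scope.
Local Open Scope sesquilinear_scope.

(** Condition (iii) says that M = A + (t+1)I is positive semidefinite, so
    Cauchy-Schwarz holds for the form of M. For a large clique C, let u_C be
    the average of the basis vectors of C. Testing M on such vectors gives:
    - a vertex is adjacent to all but few vertices of C ("attached") or to only
      few of them, so the product of e_x and u_C is close to 1 or to 0;
    - the set Q(C) of vertices attached to C is a (t^2+1)-plex;
    - if the members of C are attached to D, then u_C - u_D is almost null and
      Q(C) = Q(D);
    - if x is attached to t+1 almost disjoint cliques C_i, then
      e_x - sum_i u_{C_i} is almost null; its product with e_y is close to an
      integer, which must vanish: [x ~ y] is the number of C_i that y is
      attached to.
    By (ii), t or fewer of the plexes Q(C_i) leave many neighbours of x
    uncovered, and since a star in G has at most (t+1)^2 leaves, Ramsey's theorem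
    finds a further clique there. Hence every x has t+1 such cliques, and the
    sets Q(C_i) are t+1 lines through x that partition the edges at x. The
    hypergraph has the lines as vertices, and each x gives the edge of all
    lines through x. *)

(** * The Rayleigh bound for the smallest eigenvalue *)

(** Over [R[i]] the matrix is unitarily diagonalizable with real spectrum [d]; in the coordinates
    [w] of [v], the form is the sum of the [d 0 i * |w 0 i|^2]. *)
Lemma min_eigenvalue_le_form (R : rcfType) n (A : 'M[R]_n) (v : 'rV[R]_n) :
  A^T = A -> min_eigenvalue A * (v *m v^T) 0 0 <= (v *m A *m v^T) 0 0.
Proof.
move=> symA.
pose rc : {rmorphism R -> R[i]} := real_complex R.
pose A' : 'M[R[i]]_n := map_mx rc A; pose v' : 'rV[R[i]]_n := map_mx rc v.
have realv : map_mx Num.conj v' = v'.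
  by apply/realmxC/mxOverP=> i j; rewrite mxE; apply/complex_realP; exists (v i j).
have hermA : A' \is hermsymmx.
  apply: realsym_hermsym.
    apply/is_hermitianmxP; rewrite expr0 scale1r map_mx_id //.
    by apply/matrixP=> i j; rewrite !mxE -[in LHS]symA mxE.
  by apply/mxOverP=> i j; rewrite mxE; apply/complex_realP; exists (A i j).
have /hermitian_normalmx/orthomx_spectralP := hermA.
have := hermitian_spectral_diag_real hermA; have := spectral_unitarymx A'.
set P := spectralmx A'; set d := spectral_diag A' => unitP reald eqA.
have Punit := unitarymx_unit unitP.
have eigd i : rc (min_eigenvalue A) <= d 0 i.
  have /mxOverP/(_ 0 i)/complex_realP[k dk] := reald.
  rewrite dk lecR; apply: (min_eigenvalueP _).2.
  (* Row [i] of [P] is an eigenvector over [R[i]] for the image of the real [k], which makes [k] an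
     eigenvalue of [A]. *)
  rewrite -(eigenvalue_map rc) -/A' /= -dk.
  apply/eigenvalueP; exists (row i P).
    rewrite {1}eqA mulmxA mulmxA rowE -(mulmxA _ P) mulmxV // mulmx1.
    by rewrite -[_ *m diag_mx d]rowE row_diag_mx -scalemxAl.
  apply: contraTneq (oner_neq0 R[i]) => r0; rewrite negbK.
  have : delta_mx 0 i = 0 :> 'rV[R[i]]_n.
    by rewrite -(mulmxK Punit (delta_mx 0 i)) -rowE r0 mul0mx.
  by move/matrixP/(_ 0 i)/eqP; rewrite !mxE !eqxx.
pose w := v' *m (P ^t* ).
have trw : w ^t* = P *m v'^T.
  by rewrite /w trmx_mul map_mxM trmxCK -map_trmx realv.
have formA : v' *m A' *m v'^T = \sum_i (d 0 i * `|w 0 i| ^+ 2)%:M.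
  rewrite eqA invmx_unitary // !mulmxA -/w -mulmxA -trw.
  apply/matrixP=> i j; rewrite !ord1 summxE mxE; apply: eq_bigr => k _.
  by rewrite mul_mx_diag !mxE eqxx mulr1n normCK mulrA mulrAC mulrC mulrA.
have formI : v' *m v'^T = \sum_i (`|w 0 i| ^+ 2)%:M.
  have -> : v' *m v'^T = w *m (w ^t* ).
    by rewrite trw /w mulmxA -(mulmxA v') -invmx_unitary // mulVmx // mulmx1.
  apply/matrixP=> i j; rewrite !ord1 summxE mxE; apply: eq_bigr => k _.
  by rewrite !mxE eqxx mulr1n normCK.
rewrite -lecR -/rc rmorphM /=.
have -> : rc ((v *m v^T) 0 0) = \sum_i `|w 0 i| ^+ 2.
  have -> : rc ((v *m v^T) 0 0) = (v' *m v'^T) 0 0.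
    by rewrite map_trmx -map_mxM [RHS]mxE.
  by rewrite formI summxE; apply: eq_bigr => i _; rewrite mxE eqxx mulr1n.
have -> : rc ((v *m A *m v^T) 0 0) = \sum_i d 0 i * `|w 0 i| ^+ 2.
  have -> : rc ((v *m A *m v^T) 0 0) = (v' *m A' *m v'^T) 0 0.
    by rewrite map_trmx -!map_mxM [RHS]mxE.
  by rewrite formA summxE; apply: eq_bigr => i _; rewrite mxE eqxx mulr1n.
rewrite mulr_sumr; apply: ler_sum => i _; apply: ler_wpM2r => //.
by rewrite exprn_ge0.
Qed.

(** * Cliques and Ramsey's theorem *)

Section Graphs.

Variable G : sgraph.

Definition neighbors (x : G) (C : {set G}) := [set y in C | adj x y].
Definition nonneighbors (x : G) (C : {set G}) := [set y in C | ~~ adj x y].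
Definition clique (C : {set G}) := {in C &, forall x y, x != y -> adj x y}.

Lemma card_neighbors x C : (#|neighbors x C| + #|nonneighbors x C| = #|C|)%N.
Proof.
rewrite -(cardsID [set y | adj x y] C).
by congr addn; apply: eq_card => y; rewrite !inE // andbC.
Qed.

Lemma neighbors_clique x C : clique C -> x \in C -> neighbors x C = C :\ x.
Proof.
move=> cC xC; apply/setP=> y; rewrite !inE.
case: eqVneq => [->|yx] /=; first by rewrite adj_irrefl andbF.
by case yC: (y \in C); rewrite //= cC // eq_sym.
Qed.

End Graphs.

(** Induction on [a] and [b]: a vertex [x] extends a clique found among its neighbours, or an
    independent set found among its non-neighbours. *)
Lemma ramsey a b : exists N, forall (G : sgraph) (S : {set G}), (N <= #|S|)%N ->
  (exists T : {set G}, [/\ T \subset S, clique T & #|T| = a]) \/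
  (exists T : {set G}, [/\ T \subset S, {in T &, forall y z, ~~ adj y z} & #|T| = b]).
Proof.
elim: a b => [b|a IHa].
  exists 0%N => G S _; left; exists set0.
  by rewrite sub0set cards0; split=> // x y; rewrite inE.
elim=> [|b [N2 IHb]].
  exists 0%N => G S _; right; exists set0.
  by rewrite sub0set cards0; split=> // x y; rewrite inE.
have [N1 {}IHa] := IHa b.+1; exists (N1 + N2.+1)%N => G S SN.
have [x xS] : exists x, x \in S.
  by apply/set0Pn; rewrite -card_gt0; apply: leq_trans SN; rewrite addnS.
have nS : neighbors x S \subset S by apply/subsetP=> y; rewrite inE => /andP[].
have mS : nonneighbors x S \subset S by apply/subsetP=> y; rewrite inE => /andP[].
have xm : x \in nonneighbors x S by rewrite inE xS adj_irrefl.
(* [x] counts as its own non-neighbour, hence the [.+1] in [N2.+1]. *)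
have : (N1 <= #|neighbors x S|)%N || (N2 <= #|nonneighbors x S :\ x|)%N.
  move: SN; rewrite -(card_neighbors x S) (cardsD1 x (nonneighbors _ _)) xm.
  rewrite add1n !addnS ltnS => le_N; case: leqP => //= /ltnW ltN.
  by rewrite -(leq_add2l N1) (leq_trans le_N) // leq_add2r.
case/orP=> [/IHa | /IHb] [] [T [TS cT cardT]].
- left; exists (x |: T); have xT : x \notin T.
    by apply/negP=> /(subsetP TS); rewrite inE adj_irrefl andbF.
  have xadj y : y \in T -> adj x y by move/(subsetP TS); rewrite inE => /andP[].
  split; last by rewrite cardsU1 xT cardT.
    by rewrite subUset sub1set xS (subset_trans TS).
  move=> y z; rewrite !inE => /predU1P[->|yT] /predU1P[->|zT]; rewrite ?eqxx //.
  + by move=> _; apply: xadj.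
  + by move=> _; rewrite adj_sym xadj.
  + exact: cT.
- by right; exists T; split=> //; apply: subset_trans nS.
- left; exists T; split=> //; apply: subset_trans TS _.
  by apply: subset_trans mS; apply: subD1set.
- right; exists (x |: T); have xT : x \notin T.
    by apply/negP=> /(subsetP TS); rewrite !inE eqxx.
  have xadj y : y \in T -> ~~ adj x y.
    by move/(subsetP TS); rewrite !inE => /and3P[].
  split; last by rewrite cardsU1 xT cardT.
    rewrite subUset sub1set xS (subset_trans TS) //.
    by apply: subset_trans mS; apply: subD1set.
  move=> y z; rewrite !inE => /predU1P[->|yT] /predU1P[->|zT].
  + by rewrite adj_irrefl.
  + exact: xadj.
  + by rewrite adj_sym xadj.
  + exact: cT.
Qed.

(** * From lines through vertices to a linear hypergraph *)

(* No private vertices are needed for padding, since every vertex lies on exactly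
   t+1 lines. *)
Lemma linear_hypergraph_of_lines (G : sgraph) (t : nat)
    (line : G -> 'I_t.+1 -> {set G}) :
    (0 < t)%N ->
    (forall x i, x \in line x i) ->
    (forall x, injective (line x)) ->
    (forall x y, y != x -> adj x y = (\sum_i (y \in line x i))%N :> nat) ->
    (forall x y i, y \in line x i -> exists j, line y j = line x i) ->
  exists H, [/\ linear_hypergraph H, uniform (t + 1) H
    & isomorphic G (intersection_graph H)].
Proof.
move=> t0 self inj adjE trans.
pose E x := [set line x i | i : 'I_t.+1].
have memE x y i : (line x i \in E y) = (y \in line x i).
  by apply/imsetP/idP => [[j _ ->]|/trans[j <-]] //; exists j.
have line_uniq x y i j : y != x -> y \in line x i -> y \in line x j -> i = j.
  move=> yx yi yj; apply/eqP/contraT => ij.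
  have := adjE _ _ yx; rewrite (bigD1 i) //= (bigD1 j) 1?eq_sym //= yi yj.
  by case: adj.
have E_meet x y L L' : x != y -> L \in E x -> L \in E y -> L' \in E x ->
    L' \in E y -> L = L'.
  move=> xy /imsetP[i _ ->]; rewrite memE => yi /imsetP[j _ ->]; rewrite memE => yj.
  by congr line; apply: line_uniq yi yj; rewrite eq_sym.
(* Equal edges would share the lines of index [ord0] and [ord_max], which differ because [t] is
   positive, while distinct vertices share at most one line. *)
have E_inj : injective E.
  move=> x y Exy; apply/eqP/contraT => xy.
  have mE i : line x i \in E x by rewrite memE.
  have := E_meet x y _ _ xy (mE ord0) _ (mE ord_max); rewrite -Exy => /(_ (mE _) (mE _)).
  by move/inj/(congr1 val) => /= t00; rewrite -t00 in t0.
have E0 : set0 \notin E @: [set: G].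
  by apply/imsetP=> -[x _ /setP/(_ (line x ord0))]; rewrite memE inE self.
(* The vertices of [H] are all subsets of [G]; those that are not lines lie in no edge. *)
pose H := Hypergraph E0; exists H; split.
- move=> L L' LL'; rewrite leqNgt; apply: contra LL' => /card_gt1P[e [f [ein fin ef]]].
  move: ein fin ef; rewrite !inE => /andP[/imsetP[x _ ->] /andP[? ?]].
  move=> /andP[/imsetP[y _ ->] /andP[? ?]] ef; apply/eqP; apply: (E_meet x y) => //.
  by apply: contraNneq ef => ->.
- by move=> e /imsetP[x _ ->]; rewrite card_imset // card_ord addn1.
have EH x : E x \in hedges H by apply: imset_f.
pose f x : intersection_graph H := exist _ (E x) (EH x).
exists f.
  apply: inj_card_bij => [x y [/E_inj]//|].
  by rewrite card_sig (leq_trans (leq_imset_card E [set: G])) // cardsT.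
move=> x y; rewrite /= /iadj /= -val_eqE /= (inj_eq E_inj).
have [->|xy] := eqVneq x y; first by rewrite adj_irrefl.
rewrite /=; apply/set0Pn/idP => [[L]|].
  rewrite inE => /andP[/imsetP[i _ ->]]; rewrite memE => yi.
  by have := adjE x y; rewrite eq_sym xy (bigD1 i) //= yi => /(_ isT); case: adj.
move=> xadjy; have := adjE x y; rewrite eq_sym xy xadjy => /(_ isT).
have [/existsP[i yi] _|] := boolP [exists i, y \in line x i].
  by exists (line x i); rewrite inE !memE self.
by rewrite negb_exists => /forallP yl; rewrite big1 // => i _; rewrite (negPf (yl i)).
Qed.

(** * The bilinear form of [A + (t+1)I] *)

Section ShiftedForm.

Variables (R : realFieldType) (G : sgraph) (t : nat).

Definition form (f g : 'rV[R]_#|G|) : R :=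
  (f *m (adjmx R G + t.+1%:R%:M) *m g^T) 0 0.

Definition evec (x : G) : 'rV[R]_#|G| := delta_mx 0 (enum_rank x).

Definition indic (C : {set G}) : 'rV[R]_#|G| := \sum_(x in C) evec x.

Definition avg (C : {set G}) : 'rV[R]_#|G| := #|C|%:R^-1 *: indic C.

Lemma formDl f g h : form (f + g) h = form f h + form g h.
Proof. by rewrite /form !mulmxDl mxE. Qed.

Lemma formZl a f h : form (a *: f) h = a * form f h.
Proof. by rewrite /form -!scalemxAl mxE. Qed.

Lemma form_suml I (r : seq I) (P : pred I) (F : I -> 'rV[R]_#|G|) h :
  form (\sum_(i <- r | P i) F i) h = \sum_(i <- r | P i) form (F i) h.
Proof.
elim/big_rec2: _ => [|i a f _ <-]; last by rewrite formDl.
by rewrite /form !mul0mx mxE.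
Qed.

Lemma formC f g : form f g = form g f.
Proof.
rewrite /form -[LHS](mxE trmx_key (fun i j => _ j i)) -/(trmx _).
rewrite !trmx_mul trmxK mulmxA; congr ((_ *m _ *m _) 0 0).
rewrite linearD /= tr_scalar_mx; congr (_ + _).
by apply/matrixP=> i j; rewrite !mxE adj_sym.
Qed.

Lemma formDr f g h : form f (g + h) = form f g + form f h.
Proof. by rewrite formC formDl !(formC _ f). Qed.

Lemma formZr a f h : form f (a *: h) = a * form f h.
Proof. by rewrite formC formZl (formC h). Qed.

Lemma form_sumr I (r : seq I) (P : pred I) (F : I -> 'rV[R]_#|G|) h :
  form h (\sum_(i <- r | P i) F i) = \sum_(i <- r | P i) form h (F i).
Proof. by rewrite formC form_suml; apply: eq_bigr => i _; rewrite formC. Qed.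

Lemma formNl f h : form (- f) h = - form f h.
Proof. by rewrite -scaleN1r formZl mulN1r. Qed.

Lemma formNr f h : form f (- h) = - form f h.
Proof. by rewrite formC formNl formC. Qed.

Definition formE := (formDl, formDr, formNl, formNr).

Lemma form_evec x y :
  form (evec x) (evec y) = (adj x y)%:R + t.+1%:R *+ (x == y).
Proof.
rewrite /form /evec -rowE trmx_delta -colE !mxE !enum_rankK.
by rewrite (inj_eq enum_rank_inj).
Qed.

Lemma form_evec_indic x C :
  form (evec x) (indic C) = #|neighbors x C|%:R + t.+1%:R *+ (x \in C).
Proof.
rewrite /indic form_sumr (eq_bigr _ (fun y _ => form_evec x y)) big_split /=.
congr (_ + _).
  rewrite -sum1_card natr_sum big_mkcond [RHS]big_mkcond; apply: eq_bigr => y _.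
  by rewrite inE; case: (y \in C); case: (adj x y).
rewrite big_mkcond (bigD1 x) //= eqxx big1 ?addr0 => [|y /negPf yx].
  by case: (x \in C).
by rewrite eq_sym yx; case: (y \in C).
Qed.

Lemma form_indic_clique C : clique C ->
  form (indic C) (indic C) = #|C|%:R * (#|C| + t)%:R.
Proof.
move=> cC; rewrite {1}/indic form_suml.
rewrite (eq_bigr (fun=> (#|C| + t)%:R)) => [|x xC].
  by rewrite sumr_const mulr_natl.
rewrite form_evec_indic neighbors_clique // xC mulr1n -natrD.
by rewrite (cardsD1 x C) xC; congr _%:R; rewrite !addnS add1n.
Qed.

Lemma form_avg (C : {set G}) w (c e : R) : (0 < #|C|)%N ->
    (forall x, x \in C -> `|form (evec x) w - c| <= e) ->
  `|form (avg C) w - c| <= e.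
Proof.
move=> C0 h; have nC0 : 0 < #|C|%:R :> R by rewrite ltr0n.
have -> : form (avg C) w - c = #|C|%:R^-1 * \sum_(x in C) (form (evec x) w - c).
  rewrite sumrB sumr_const mulrBr -[c *+ _]mulr_natl formZl form_suml.
  by rewrite mulrA mulVf ?gt_eqF // mul1r.
rewrite normrM gtr0_norm ?invr_gt0 // mulrC ler_pdivrMr //.
apply: le_trans (ler_norm_sum _ _ _) _.
rewrite mulr_natr -sumr_const; apply: ler_sum => x; exact: h.
Qed.

(** * Consequences of positive semidefiniteness *)

Hypothesis form_ge0 : forall f, 0 <= form f f.

Lemma form_CauchySchwarz f g : form f g ^+ 2 <= form f f * form g g.
Proof.
set a := form f f; set b := form f g; set c := form g g.
have qf u v : 0 <= u ^+ 2 * a + 2 * u * v * b + v ^+ 2 * c.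
  have := form_ge0 (u *: f + v *: g).
  by rewrite !(formE, formZl, formZr) (formC g f) -/a -/b -/c; congr (0 <= _); ring.
have := form_ge0 g; rewrite -/c le_eqVlt => /predU1P[c0|c_gt0].
  rewrite -c0 mulr0; have := qf b (- ((a + 1) / 2)); rewrite -c0 mulr0 addr0.
  by have := form_ge0 f; rewrite -/a; nra.
by have := qf c (- b); nra.
Qed.

(** For an independent [I], [indic I] has squared norm [(t+1)|I|] and product [|I|] with [evec x],
    so Cauchy-Schwarz gives [|I|^2 <= (t+1)^2 |I|]. *)
Lemma star_bound (x : G) (I : {set G}) : {in I &, forall y z, ~~ adj y z} ->
  {in I, forall y, adj x y} -> (#|I| <= t.+1 ^ 2)%N.
Proof.
move=> indI xI.
have xNI : x \notin I by apply/negP=> /xI; rewrite adj_irrefl.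
have := form_CauchySchwarz (evec x) (indic I).
rewrite form_evec eqxx adj_irrefl add0r mulr1n form_evec_indic (negPf xNI) addr0.
have -> : neighbors x I = I.
  by apply/setP=> y; rewrite inE andb_idr // => /xI.
have -> : form (indic I) (indic I) = #|I|%:R * t.+1%:R.
  rewrite {1}/indic form_suml (eq_bigr (fun=> t.+1%:R)) => [|y yI].
    by rewrite sumr_const mulr_natl.
  rewrite form_evec_indic yI mulr1n.
  have -> : neighbors y I = set0; last by rewrite cards0 add0r.
  by apply/setP=> z; rewrite !inE; apply/andP=> -[zI]; apply/negP/indI.
rewrite -natrX -!natrM ler_nat mulnCA -mulnn.
by case: (posnP #|I|) => [->//|I0]; rewrite leq_pmul2l.
Qed.

(* The threshold comes from pairing e_x with the difference of the averages of
   the neighbours and of the non-neighbours of x in C. *)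
Definition tol := (2 * t * t.+1)%N.

Lemma neighbors_dichotomy (x : G) (C : {set G}) : (0 < t)%N -> clique C -> x \notin C ->
  (#|neighbors x C| <= tol)%N || (#|nonneighbors x C| <= tol)%N.
Proof.
move=> t0 cC xC; apply: contraT; rewrite negb_or -!ltnNge => /andP[].
set P := neighbors x C; set Q := nonneighbors x C => hP hQ.
have p0 : 0 < #|P|%:R :> R by rewrite ltr0n (leq_ltn_trans _ hP).
have q0 : 0 < #|Q|%:R :> R by rewrite ltr0n (leq_ltn_trans _ hQ).
have PC : P \subset C by apply/subsetP=> y; rewrite inE => /andP[].
have QC : Q \subset C by apply/subsetP=> y; rewrite inE => /andP[].
have sub_clique (A : {set G}) : A \subset C -> clique A.
  by move=> /subsetP AC y z /AC yC /AC zC; apply: cC.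
have cP := sub_clique _ PC; have cQ := sub_clique _ QC.
have xP : x \notin P by apply: contra xC; apply: (subsetP PC).
have xQ : x \notin Q by apply: contra xC; apply: (subsetP QC).
have eP : neighbors x P = P.
  by apply/setP=> y; rewrite !inE -andbA andbb.
have eQ : neighbors x Q = set0.
  by apply/setP=> y; rewrite !inE -andbA andNb andbF.
have formPQ : form (indic P) (indic Q) = #|P|%:R * #|Q|%:R.
  rewrite {1}/indic form_suml (eq_bigr (fun=> #|Q|%:R)) => [|y yP].
    by rewrite sumr_const mulr_natl.
  have yQ : y \notin Q by move: yP; rewrite !inE => /andP[-> ->].
  rewrite form_evec_indic (negPf yQ) addr0; congr _%:R.
  apply: eq_card => z; rewrite [LHS]inE andb_idr // => zQ.
  apply: cC; [exact: (subsetP PC) | exact: (subsetP QC) | ].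
  by apply: contraNneq yQ => ->.
have := form_CauchySchwarz (evec x) (avg P - avg Q).
rewrite /avg !(formE, formZl, formZr) !form_indic_clique // (formC (indic Q)) formPQ.
rewrite !form_evec_indic (negPf xP) (negPf xQ) eP eQ cards0 form_evec eqxx.
rewrite adj_irrefl !addr0 add0r mulr1n !natrD.
(* The left side is [1] because [x] sees all of [P] and none of [Q]; the squared norm of
   [avg P - avg Q] is [(1 + t/p) - 2 + (1 + t/q)], with [p = |P|] and [q = |Q|]. *)
rewrite [X in X <= _](_ : _ = 1); last by field; rewrite !gt_eqF.
rewrite [X in _ <= _ * X](_ : _ = t%:R * (#|P|%:R^-1 + #|Q|%:R^-1)); last first.
  by field; rewrite !gt_eqF.
rewrite leNgt => /negP[].
have t0' : 0 < t%:R :> R by rewrite ltr0n.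
have tol_gt0 : 0 < tol%:R :> R by rewrite ltr0n !muln_gt0 t0.
have tolE : tol%:R = 2 * t%:R * t.+1%:R :> R by rewrite !natrM.
have ip : #|P|%:R^-1 < tol%:R^-1 :> R by rewrite ltf_pV2 ?posrE // ltr_nat.
have iq : #|Q|%:R^-1 < tol%:R^-1 :> R by rewrite ltf_pV2 ?posrE // ltr_nat.
rewrite [ltRHS](_ : _ = t.+1%:R * (t%:R * (tol%:R^-1 + tol%:R^-1))); last first.
  have l0 : 0 < t.+1%:R :> R by rewrite ltr0n.
  by rewrite tolE; move: t.+1%:R l0 => l l0; field; rewrite !gt_eqF.
by rewrite !ltr_pM2l ?ltr0n // ltrD.
Qed.


(** * Large cliques and the vertices attached to them *)

Definition attached (x : G) (C : {set G}) := (#|nonneighbors x C| <= tol)%N.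
Definition quasi_clique (C : {set G}) := [set x | attached x C].

(* [eps] bounds the errors tol / |C|. With this value the errors of the
   Cauchy-Schwarz tests below, at most a small multiple of (t+1)^3 [eps], are
   too small to move an integer. *)
Definition eps : R := (100 * t.+1 ^ 3)%N%:R^-1.
Definition large_clique (C : {set G}) := clique C /\ (tol * (100 * t.+1 ^ 3) <= #|C|)%N.

Hypothesis t_gt0 : (0 < t)%N.

Lemma eps_gt0 : 0 < eps.
Proof. by rewrite invr_gt0 ltr0n muln_gt0 expn_gt0. Qed.

Lemma epsE : 100 * eps * t.+1%:R ^+ 3 = 1.
Proof.
rewrite /eps natrM natrX.
have : 0 < t.+1%:R :> R by rewrite ltr0n.
by move: t.+1%:R => l l0; field; rewrite !gt_eqF.
Qed.

Lemma large_clique_gt C : large_clique C -> (2 * tol < #|C|)%N.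
Proof.
case=> _; apply: leq_trans; rewrite mulnC ltn_pmul2l ?muln_gt0 ?t_gt0 //.
by rewrite (@leq_trans 100) // leq_pmulr // expn_gt0.
Qed.

Lemma large_clique_eps C k : large_clique C -> (k <= tol)%N ->
  k%:R / #|C|%:R <= eps.
Proof.
move=> lC ktol; have C0 : 0 < #|C|%:R :> R.
  by rewrite ltr0n (leq_ltn_trans _ (large_clique_gt lC)).
rewrite ler_pdivrMr // /eps mulrC ler_pdivlMr ?ltr0n ?muln_gt0 ?expn_gt0 //.
rewrite -natrM ler_nat; apply: leq_trans lC.2.
by rewrite leq_mul2r ktol orbT.
Qed.

Lemma attached_mem (x : G) (C : {set G}) : clique C -> x \in C -> attached x C.
Proof.
move=> cC xC; have := card_neighbors x C; rewrite neighbors_clique //.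
rewrite [#|C|](cardsD1 x) xC addnC => /addIn; rewrite /attached => ->.
by rewrite !muln_gt0 t_gt0.
Qed.

Lemma not_attached (x : G) (C : {set G}) : clique C -> ~~ attached x C ->
  x \notin C /\ (#|neighbors x C| <= tol)%N.
Proof.
move=> cC nxC; have xC : x \notin C by apply: contra nxC; apply: attached_mem.
by split=> //; have /orP[|/(negP nxC)] := neighbors_dichotomy t_gt0 cC xC.
Qed.

(** A vertex not attached to [C] has at most [tol] neighbours in [C], hence in [D]; since [D] has
    more than [2 * tol] members, it is not attached to [D]. The other direction is inclusion of the
    non-neighbours. *)
Lemma attached_sub x (C D : {set G}) :
  large_clique C -> large_clique D -> D \subset C -> attached x D = attached x C.
Proof.
move=> lC lD /subsetP DC; apply/idP/idP => [xD|]; last first.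
  apply/leq_trans/subset_leq_card/subsetP => y.
  by rewrite !inE => /andP[/DC-> ->].
apply: contraLR xD => /(not_attached lC.1)[_ nxC].
rewrite -ltnNge -(ltn_add2l #|neighbors x D|) card_neighbors.
apply: leq_ltn_trans (large_clique_gt lD); rewrite mul2n -addnn leq_add2r.
apply: leq_trans nxC; apply/subset_leq_card/subsetP => y.
by rewrite !inE => /andP[/DC-> ->].
Qed.

Lemma form_evec_avg x C : large_clique C ->
  `|form (evec x) (avg C) - (attached x C)%:R| <= eps.
Proof.
move=> lC; rewrite formZr form_evec_indic.
have C0 : 0 < #|C|%:R :> R.
  by rewrite ltr0n (leq_ltn_trans _ (large_clique_gt lC)).
have CE : #|C|%:R = #|neighbors x C|%:R + #|nonneighbors x C|%:R :> R.
  by rewrite -natrD card_neighbors.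
have [xC|nxC] := boolP (attached x C); last first.
  have [nx nbx] := not_attached lC.1 nxC.
  rewrite (negPf nx) addr0 subr0 ger0_norm ?mulr_ge0 ?invr_ge0 //.
  by rewrite mulrC large_clique_eps.
have [inC|ninC] := boolP (x \in C).
  (* For [x] in [C], the diagonal entry [t+1] exceeds the missing self-adjacency by [t], so the
     error is [t / |C|]. *)
  have -> : #|C|%:R^-1 * (#|neighbors x C|%:R + t.+1%:R *+ true) - true%:R
      = t%:R / #|C|%:R :> R.
    rewrite [in LHS]neighbors_clique //; last exact: lC.1.
    have -> : #|C|%:R = 1 + #|C :\ x|%:R :> R.
      by rewrite [in LHS](cardsD1 x) inC natrD.
    by rewrite !mulr1n -natr1; field; rewrite gt_eqF // ltr_wpDr.
  rewrite ger0_norm ?divr_ge0 // large_clique_eps //.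
  by rewrite /tol mulnAC leq_pmull // muln_gt0.
rewrite addr0 mulr1n.
have -> : #|C|%:R^-1 * #|neighbors x C|%:R - 1 =
    - (#|nonneighbors x C|%:R / #|C|%:R) :> R.
  by move: C0; rewrite CE => C0; field; rewrite gt_eqF.
by rewrite normrN ger0_norm ?divr_ge0 // large_clique_eps.
Qed.

Lemma form_avg_avg b C D : large_clique C -> large_clique D ->
    (forall x, x \in C -> attached x D = b) ->
  `|form (avg C) (avg D) - b%:R| <= eps.
Proof.
move=> lC lD CD; apply: form_avg => [|x xC].
  by rewrite (leq_ltn_trans _ (large_clique_gt lC)).
by rewrite -(CD x xC) form_evec_avg.
Qed.

Lemma form_avg_self C : large_clique C -> `|form (avg C) (avg C) - 1| <= eps.
Proof.
by move=> lC; apply: (form_avg_avg (b := true)) => // x; apply: attached_mem lC.1.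
Qed.

Lemma form_evec_self x : form (evec x) (evec x) = t.+1%:R.
Proof. by rewrite form_evec adj_irrefl eqxx add0r. Qed.

(** [epsE] and its consequences for lower powers, with [t.+1%:R] made an opaque [l] for [lra] and
    [nra]. *)
Lemma eps_small : exists2 l : R, 1 <= l &
  t.+1%:R = l /\ [/\ 100 * eps * l ^+ 3 = 1, 100 * eps <= 1,
    100 * eps * l <= 1 & 100 * eps * l ^+ 2 <= 1].
Proof.
have l1 : 1 <= t.+1%:R :> R by rewrite ler1n.
have e0 := eps_gt0; have := epsE; exists t.+1%:R => //; split=> //.
move: t.+1%:R l1 H => l l1 H.
have el a b : (a <= b)%N -> 100 * eps * l ^+ a <= 100 * eps * l ^+ b.
  by move=> ab; rewrite ler_wpM2l ?mulr_ge0 ?(ltW e0) // ler_weXn2l.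
have := (el 0 3, el 1 3, el 2 3)%N; rewrite H expr0 mulr1 expr1.
by case=> [[/(_ isT) e1 /(_ isT) e2] /(_ isT) e3].
Qed.

Lemma quasi_clique_attached_eq C D : large_clique C -> large_clique D ->
  (forall x, x \in C -> attached x D) -> quasi_clique C = quasi_clique D.
Proof.
move=> lC lD CD; apply/setP=> z; rewrite !inE.
have := form_avg_self lC; rewrite ler_distl => /andP[_ hCC].
have := form_avg_self lD; rewrite ler_distl => /andP[_ hDD].
have := form_avg_avg (b := true) lC lD CD; rewrite mulr1n ler_distl => /andP[hCD _].
have := form_CauchySchwarz (evec z) (avg C - avg D).
rewrite !formE (formC (avg D) (avg C)) form_evec_self.
have := form_evec_avg z lC; have := form_evec_avg z lD.
have [l l1 [-> [_ e1 el _]]] := eps_small; have e0 := eps_gt0.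
move: (form (avg C) (avg C)) (form (avg C) (avg D)) (form (avg D) (avg D))
  hCC hCD hDD (form _ (avg C)) (form _ (avg D)) => cc cd dd hCC hCD hDD zc zd.
rewrite !ler_distl => /andP[hd hd'] /andP[hc hc'] CS.
(* The squared norm of [avg C - avg D] is at most [(1 + eps) - 2 (1 - eps) + (1 + eps) = 4 eps].
   Hence [|zc - zd| <= 1/5], whereas different attachments would put [zc] and [zd] almost 1
   apart. *)
have {}CS : (zc - zd) ^+ 2 <= l * (4 * eps).
  by apply: le_trans CS _; rewrite ler_pM2l; lra.
by case: (attached z C) hc hc' => /=; case: (attached z D) hd hd' => /= *;
  rewrite // ; exfalso; nra.
Qed.

Lemma quasi_clique_plex C : large_clique C -> plex (t ^ 2 + 1) (quasi_clique C).
Proof.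
move=> lC y; rewrite inE => yC; rewrite addnK leqNgt; apply/negP.
set Z := [set z in _ | _] => Zt.
pose w x := evec x - avg C.
(* Pairing [w y] with the sum of [w z] over s non-neighbours z of y in Q(C) gives
   about -s, while the squared norms are about t and at most about s t;
   so s^2 <= t * (s t), up to errors. *)
have wE b x z : attached x C -> attached z C ->
    form (evec x) (evec z) = b -> form (w x) (w z) <= b - 1 + 3 * eps.
  move=> xC zC xz; rewrite !formE xz (formC (avg C) (evec z)).
  have := form_avg_self lC; rewrite ler_distl => /andP[_ hCC].
  have := form_evec_avg x lC; rewrite xC mulr1n ler_distl => /andP[hx _].
  by have := form_evec_avg z lC; rewrite zC mulr1n ler_distl => /andP[hz _]; lra.
have ZC z : z \in Z -> attached z C by rewrite !inE => /andP[].
have := form_CauchySchwarz (w y) (\sum_(z in Z) w z).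
have {wE yC ZC} : [/\ form (w y) (w y) <= t%:R + 3 * eps,
    form (w y) (\sum_(z in Z) w z) <= (- 1 + 3 * eps) * #|Z|%:R &
    form (\sum_(z in Z) w z) (\sum_(z in Z) w z) <=
      (3 * eps * #|Z|%:R + t%:R) * #|Z|%:R].
  split.
  - by apply: le_trans (wE _ _ _ yC yC (form_evec_self y)) _; rewrite -natr1 addrK.
  - rewrite form_sumr mulr_natr -sumr_const; apply: ler_sum => z zZ.
    apply: le_trans (wE 0 _ _ yC (ZC z zZ) _) _; last by rewrite sub0r.
    move: zZ; rewrite !inE form_evec => /andP[_ /andP[zy /negPf->]].
    by rewrite eq_sym (negPf zy) addr0.
  rewrite form_suml mulr_natr -sumr_const; apply: ler_sum => z zZ.
  (* The diagonal term gives [t + 3 eps]; every other term is at most [3 eps], since an adjacency is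
     at most 1. *)
  rewrite form_sumr (bigD1 z) //= addrC.
  rewrite (cardsD1 z) zZ natrD mulrDr mulr1 (addrC (3 * eps)) -addrA.
  rewrite lerD //; last first.
    apply: le_trans (wE _ _ _ (ZC z zZ) (ZC z zZ) (form_evec_self z)) _.
    by rewrite -natr1 addrK addrC.
  rewrite mulr_natr -sumr_const big_mkcond [leRHS]big_mkcond; apply: ler_sum => u _.
  rewrite in_setD1 andbC; case: ifP => // /andP[uz uZ].
  apply: le_trans (wE _ _ _ (ZC z zZ) (ZC u uZ) (erefl _)) _.
  rewrite form_evec eq_sym (negPf uz) addr0 gerDr subr_le0.
  by case: adj.
have [l l1 [lE [e3 e e1 _]]] := eps_small; have e0 := eps_gt0.
move: (form_ge0 (\sum_(z in Z) w z)).
have tl : l = t%:R + 1 by rewrite -lE -natr1.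
have t1 : 1 <= t%:R :> R by rewrite ler1n.
have sZ : t%:R ^+ 2 + 1 <= #|Z|%:R :> R by rewrite -natrX natr1 ler_nat.
move: (form (w y) (w y)) (form (w y) (\sum_(z in Z) w z))
  (form (\sum_(z in Z) w z) (\sum_(z in Z) w z)) t%:R #|Z|%:R tl t1 sZ.
move=> a b c u s tl u1 sZ c0 [ha hb hc] CS.
have s0 : 0 < s by have := sqr_ge0 u; lra.
have {CS} : s * (s * (1 - 3 * eps) ^+ 2) <= s * ((u + 3 * eps) * (3 * eps * s + u)).
  have sb : 0 <= s * (1 - 3 * eps) <= - b.
    by apply/andP; split; [rewrite mulr_ge0 //|]; lra.
  have -> : s * (s * (1 - 3 * eps) ^+ 2) = (s * (1 - 3 * eps)) ^+ 2 by ring.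
  apply: (@le_trans _ _ ((- b) ^+ 2)).
    by case/andP: sb => ? ?; rewrite lerXn2r ?nnegrE //; lra.
  rewrite sqrrN.
  apply: le_trans CS _; rewrite mulrCA (mulrC s); apply: le_trans (_ : (u + 3 * eps) * c <= _).
    by rewrite ler_wpM2r.
  by rewrite ler_wpM2l //; lra.
rewrite ler_pM2l // leNgt => /negP; apply.
have e36 : 100 * (eps + eps * u + eps * u ^+ 2 + eps * u ^+ 3) <= 1.
  have : 0 <= 200 * eps * u * (u + 1) by rewrite !mulr_ge0 //; lra.
  by move: e3; rewrite tl; lra.
have eu : 0 <= eps * u by rewrite mulr_ge0; lra.
have eu2 : 0 <= eps * u ^+ 2 by rewrite mulr_ge0 ?exprn_ge0; lra.
have eu3 : 0 <= eps * u ^+ 3 by rewrite mulr_ge0 ?exprn_ge0; lra.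
rewrite -subr_gt0.
(* The excess of [s] over [u ^+ 2 + 1] gets a non-negative coefficient, and the remaining errors do
   not use up the 1. *)
have -> : s * (1 - 3 * eps) ^+ 2 - (u + 3 * eps) * (3 * eps * s + u) =
    (s - (u ^+ 2 + 1)) * (1 - 6 * eps - 3 * (eps * u)) +
    (1 - 6 * eps - 6 * (eps * u) - 6 * (eps * u ^+ 2) - 3 * (eps * u ^+ 3)).
  by ring.
by rewrite ltr_wpDl ?mulr_ge0 //; lra.
Qed.

(** * Lines through a vertex *)

(** The [t+1] averages are almost orthonormal, and [evec x] has squared norm [t+1] and product about
    1 with each of them, so [w] below is almost null. *)
Lemma adj_sum_attached x (U : 'I_t.+1 -> {set G}) :
    (forall i, large_clique (U i)) -> (forall i, attached x (U i)) ->
    (forall i j : 'I_t.+1, (i < j)%N ->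
       forall y, y \in U j -> ~~ attached y (U i)) ->
  forall y, y != x -> adj x y = (\sum_i attached y (U i))%N :> nat.
Proof.
move=> lU xU Udisj y yx.
(* [Udisj] covers only [i < j]; symmetry of the form gives the other order. *)
have UU i j : `|form (avg (U i)) (avg (U j)) - (i == j)%:R| <= eps.
  case: eqVneq => [<-|]; first exact: form_avg_self.
  rewrite -(inj_eq val_inj) neq_ltn => /orP[] ij.
    by rewrite formC; apply: form_avg_avg => // z /(Udisj _ _ ij)/negPf.
  by apply: form_avg_avg => // z /(Udisj _ _ ij)/negPf.
pose w := evec x - \sum_i avg (U i).
(* Used for [v = evec z] with [b] its attachments, and for [v = avg (U j)] with [b] a unit
   vector. *)
have wE v (b : 'I_t.+1 -> nat) : (forall i, `|form (avg (U i)) v - (b i)%:R| <= eps) ->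
    `|form w v - (form (evec x) v - (\sum_i b i)%:R)| <= t.+1%:R * eps.
  move=> vb; rewrite !formE form_suml.
  rewrite [X in `|X|](_ : _ = (\sum_i b i)%:R - \sum_i form (avg (U i)) v); last by ring.
  rewrite natr_sum -sumrB.
  apply: le_trans (ler_norm_sum _ _ _) _.
  rewrite mulr_natl -[X in _ *+ X]card_ord -sumr_const.
  by apply: ler_sum => i _; rewrite distrC.
have := form_CauchySchwarz w (evec y).
have wz z : `|form w (evec z) -
    (form (evec x) (evec z) - (\sum_i attached z (U i))%N%:R)| <= t.+1%:R * eps.
  by apply: wE => i; rewrite formC; apply: form_evec_avg.
have := wz y; have := wz x.
rewrite form_evec_self (eq_bigr (fun=> 1%N)) => [|i _]; last by rewrite xU.
rewrite sum1_card card_ord subrr subr0 ler_norml => /andP[_ wx].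
rewrite form_evec eq_sym (negPf yx) addr0 ler_distl => /andP[wy1 wy2].
have wU j : - (form w (avg (U j))) <= (1 + t.+1%:R) * eps.
  have := wE (avg (U j)) (fun i => i == j) (UU^~ j).
  have := form_evec_avg x (lU j); rewrite xU.
  rewrite (bigD1 j) //= eqxx big1 => [|i /negPf-> //].
  by rewrite addn0 !mulr1n !ler_distl => /andP[? ?] /andP[? ?]; lra.
have ww : form w w <= t.+1%:R * eps + t.+1%:R * ((1 + t.+1%:R) * eps).
  rewrite {2}/w formDr formNr form_sumr -sumrN lerD //.
  rewrite [leRHS]mulr_natl -[X in _ *+ X]card_ord -sumr_const.
  by apply: ler_sum => i _; exact: wU.
rewrite form_evec_self.
have [l l1 [lE [e3 e e1 e2]]] := eps_small; have e0 := eps_gt0.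
move: ww wy1 wy2; rewrite lE; move: (form w w) (form w (evec y)) => ww wy.
move=> wwe wy1 wy2 CS.
have {}CS : wy ^+ 2 <= 3 / 100.
  apply: le_trans CS _; apply: le_trans (_ : (l * eps + l * ((1 + l) * eps)) * l <= _).
    by rewrite ler_wpM2r //; lra.
  have -> : (l * eps + l * ((1 + l) * eps)) * l = 2 * (eps * l ^+ 2) + eps * l ^+ 3.
    by ring.
  by lra.
(* This bound and the error [l * eps <= 1/100] leave the two integers less than 1 apart. *)
have [wy3 wy4] : - (1 / 2) <= wy /\ wy <= 1 / 2 by split; nra.
have lt1_le m n : m%:R < n%:R + 1 :> R -> (m <= n)%N by rewrite natr1 ltr_nat ltnS.
by apply/eqP; rewrite eqn_leq; apply/andP; split; apply: lt1_le; lra.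
Qed.

(* Pigeonhole over the t+1 cliques of a vertex y: if y is attached to a clique of
   this order, one of them has [tol * (100 * t.+1 ^ 3)] attached members in it. *)
Definition clique_order := (tol * (100 * t.+1 ^ 3) * t.+1 + tol)%N.

Lemma large_clique_order (C : {set G}) :
  clique C -> #|C| = clique_order -> large_clique C.
Proof.
move=> cC Cn; split; rewrite // Cn; apply: leq_trans (leq_addr _ _).
exact: leq_pmulr.
Qed.

(** Greedy choice: [k <= t] plexes [quasi_clique (U i)] cover at most [degree x - K] vertices, so at
    least [K] neighbours of [x] remain for Ramsey's theorem. [star_bound] excludes the independent
    set, and a clique found there has no member attached to an earlier one. *)
Lemma exists_attached_cliques (K : nat) x :
    (forall S : {set G}, (K <= #|S|)%N ->
      (exists T : {set G}, [/\ T \subset S, clique T & #|T| = clique_order]) \/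
      (exists T : {set G}, [/\ T \subset S, {in T &, forall y z, ~~ adj y z}
         & #|T| = (t.+1 ^ 2).+1])) ->
    (K <= degree x)%N ->
    (forall S : {set G}, plex (t ^ 2 + 1) S -> x \in S ->
      (t * #|S| + K <= degree x)%N) ->
  exists U : 'I_t.+1 -> {set G},
    [/\ forall i, large_clique (U i), forall i, #|U i| = clique_order,
        forall i, attached x (U i) &
        forall i j : 'I_t.+1, (i < j)%N ->
          forall y, y \in U j -> ~~ attached y (U i)].
Proof.
move=> ramK Kd plexK.
suff [U [Uc xU Udisj]] : exists U : nat -> {set G},
    [/\ forall i, (i < t.+1)%N -> clique (U i) /\ #|U i| = clique_order,
        forall i, (i < t.+1)%N -> attached x (U i) &
        forall i j, (i < j < t.+1)%N -> forall y, y \in U j -> ~~ attached y (U i)].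
  have Uc' (i : 'I_t.+1) := Uc i (ltn_ord i).
  exists U; split=> [i|i|i|i j ij y].
  - by case: (Uc' i); apply: large_clique_order.
  - by case: (Uc' i).
  - exact: xU.
  - by apply: Udisj; rewrite ij /=.
have : (t.+1 <= t.+1)%N by [].
elim: {-2}t.+1 => [_|k IHk kt].
  by exists (fun=> set0); split=> // i j; rewrite ltn0 andbF.
have [U [Uc xU Udisj]] := IHk (ltnW kt).
pose S := [set y | adj x y] :\: \bigcup_(i < k) quasi_clique (U i).
have KS : (K <= #|S|)%N.
  rewrite cardsD -/(degree x) -[K in (K <= _)%N](subKn Kd) leq_sub2l //.
  apply: leq_trans (subset_leq_card (subsetIr _ _)) _.
  apply: (@leq_trans (\sum_(i < k) #|quasi_clique (U i)|)).
    elim/big_rec2: _ => [|i m B _ mB]; first by rewrite cards0.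
    by apply: leq_trans (leq_card_setU _ _) _; rewrite leq_add2l.
  rewrite -(leq_pmul2l t_gt0) big_distrr /=.
  apply: (@leq_trans (\sum_(i < k) (degree x - K))).
    apply: leq_sum => i _; rewrite leq_subRL // addnC; apply: plexK.
      by apply: quasi_clique_plex; case: (Uc i) => // ? ?; apply: large_clique_order.
    by rewrite inE xU.
  by rewrite sum_nat_const card_ord leq_mul2r -ltnS kt orbT.
have [[T [TS cT Tn]]|[T [TS iT Tn]]] := ramK _ KS; last first.
  have := star_bound iT; rewrite Tn ltnn => /(_ x) h; exfalso.
  by apply: notF; apply: h => y /(subsetP TS); rewrite !inE => /andP[].
exists (fun i => if i == k then T else U i); split=> [i|i|i j].
- by rewrite ltnS leq_eqVlt; case: eqP => //= _; apply: Uc.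
- rewrite ltnS leq_eqVlt; case: eqP => [_ _|_] /=; last exact: xU.
  rewrite /attached (_ : nonneighbors x T = set0) ?cards0 //.
  apply/setP=> y; rewrite !inE; apply/negP=> /andP[/(subsetP TS)].
  by rewrite !inE => /andP[_ ->].
rewrite ltnS => /andP[ij jk]; have ik := leq_trans ij jk; rewrite (ltn_eqF ik).
case: eqP jk => [-> _|/eqP jk jk'] y; last first.
  by apply: Udisj; rewrite ij ltn_neqAle jk.
move/(subsetP TS); rewrite !inE => /andP[yQ _]; apply: contra yQ => yi.
by apply/bigcupP; exists (Ordinal ik); rewrite ?inE.
Qed.

(** A large [D j] links the two cliques: it has the quasi-clique of [C] by [attached_sub], and that
    of [U y j] by [quasi_clique_attached_eq]. *)
Lemma quasi_clique_trans (U : G -> 'I_t.+1 -> {set G}) :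
    (forall x i, large_clique (U x i)) -> (forall x i, #|U x i| = clique_order) ->
    (forall x y, y != x -> adj x y = (\sum_i attached y (U x i))%N :> nat) ->
  forall x y i, attached y (U x i) ->
    exists j, quasi_clique (U y j) = quasi_clique (U x i).
Proof.
move=> lU nU adjU x y i yC; set C := U x i in yC *.
pose D j := [set z in C | attached z (U y j)].
have DC j : D j \subset C by apply/subsetP=> z; rewrite inE => /andP[].
have [j Dj] : exists j, (tol * (100 * t.+1 ^ 3) <= #|D j|)%N.
  apply/existsP; apply: contraT; rewrite negb_exists => /forallP smallD.
  (* By [adjU], each neighbour of [y] is attached to exactly one clique of [y]. *)
  have : (#|neighbors y C| <= \sum_j #|D j|)%N.
    rewrite -sum1_card (eq_bigr (fun z => \sum_j attached z (U y j))%N) => [|z].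
      rewrite exchange_big /=; apply: leq_sum => j _.
      rewrite -sum1_card big_mkcond [leqRHS]big_mkcond; apply: leq_sum => z _.
      by rewrite !inE; case: (z \in C); case: attached; case: adj.
    rewrite inE => /andP[_ yz]; rewrite -adjU ?yz //.
    by apply: contraTneq yz => ->; rewrite adj_irrefl.
  rewrite leqNgt => /negP[].
  apply: (@leq_ltn_trans (\sum_(j < t.+1) (tol * (100 * t.+1 ^ 3)).-1)).
    apply: leq_sum => j _; have := smallD j.
    by rewrite -ltnNge; case: (tol * _)%N.
  rewrite sum_nat_const card_ord -(ltn_add2r #|nonneighbors y C|) card_neighbors.
  rewrite nU /clique_order.
  apply: (@leq_ltn_trans (t.+1 * (tol * (100 * t.+1 ^ 3)).-1 + tol)).
    by rewrite leq_add2l.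
  by rewrite ltn_add2r mulnC ltn_pmul2r // ltn_predL muln_gt0 !muln_gt0 t_gt0.
have lD : large_clique (D j).
  by split=> // u v /(subsetP (DC j)) uC /(subsetP (DC j)); apply: (lU x i).1.
exists j; rewrite -(@quasi_clique_attached_eq (D j)) //.
  by apply/setP=> z; rewrite !inE; apply: attached_sub (lU x i) lD (DC j).
by move=> z; rewrite inE => /andP[].
Qed.

End ShiftedForm.

Theorem theorem1p2 (R : realType) (t : nat) (t_gt0 : (0 < t)%N) :
  exists K : nat, (0 < K)%N /\
    forall G : sgraph,
      (forall x : G, (K < degree x)%N) ->
      (forall (x : G) (S : {set G}), plex (t ^ 2 + 1) S -> x \in S ->
         (#|S|%:R : R) <= ((degree x)%:R - K%:R) / t%:R) ->
      - t%:R - 1 <= lambda_min R G ->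
      exists H : hypergraph,
        [/\ linear_hypergraph H, uniform (t + 1) H
          & isomorphic G (intersection_graph H)].
Proof.
(* The independent sets are one larger than [star_bound] allows inside a neighbourhood. *)
have [N ramN] := ramsey (clique_order t) (t.+1 ^ 2).+1.
exists N.+1; split=> // G degK plexK lamG.
have form_ge0 (f : 'rV[R]_#|G|) : 0 <= form t f f.
  have symA : (adjmx R G)^T = adjmx R G.
    by apply/matrixP=> i j; rewrite !mxE adj_sym.
  have ff : 0 <= (f *m f^T) 0 0.
    by rewrite mxE sumr_ge0 // => i _; rewrite mxE -expr2 sqr_ge0.
  have fAf := le_trans (ler_wpM2r ff lamG) (min_eigenvalue_le_form f symA).
  rewrite /form mulmxDr mulmxDl mul_mx_scalar -scalemxAl mxE [X in _ + X]mxE -natr1.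
  by lra.
have plexN (x : G) (S : {set G}) : plex (t ^ 2 + 1) S -> x \in S ->
    (t * #|S| + N.+1 <= degree x)%N.
  move=> /plexK/[apply]; rewrite ler_pdivlMr ?ltr0n // lerBrDr.
  by rewrite -natrM -natrD ler_nat mulnC.
have [U UP] := fin_all_exists (fun x : G => exists_attached_cliques form_ge0 t_gt0
  (fun S NS => ramN G S (ltnW NS)) (ltnW (degK x)) (@plexN x)).
have lU x i : large_clique t (U x i) by case: (UP x).
have nU x i : #|U x i| = clique_order t by case: (UP x).
have xU x i : attached t x (U x i) by case: (UP x).
have adjU x y : y != x -> adj x y = (\sum_i attached t y (U x i))%N :> nat.
  by case: (UP x) => *; apply: (adj_sum_attached form_ge0).
pose line x i := quasi_clique t (U x i).
apply: (@linear_hypergraph_of_lines G t line) => //.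
- by move=> x i; rewrite inE.
(* If two lines of [x] coincided, another member [y] of [U x i] would be counted twice in a sum that
   equals a Boolean. *)
- move=> x i j /setP ij; apply/eqP/contraT => ij_neq.
  have /set0Pn[y] : U x i :\ x != set0.
    rewrite -card_gt0; have := large_clique_gt t_gt0 (lU x i).
    rewrite (cardsD1 x); case: (#|_ :\ x|) => //.
    by rewrite addn0 ltnNge (leq_trans (leq_b1 _)) // muln_gt0 !muln_gt0 t_gt0.
  rewrite !inE => /andP[yx yi].
  have {}yi : attached t y (U x i) by apply: attached_mem (lU x i).1 yi.
  have yj : attached t y (U x j) by have := ij y; rewrite !inE yi.
  have := adjU _ _ yx; rewrite (bigD1 i) //= (bigD1 j) 1?eq_sym //= yi yj.
  by case: adj.
- by move=> x y yx; rewrite adjU //; apply: eq_bigr => i _; rewrite inE.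
move=> x y i; rewrite inE.
exact: quasi_clique_trans.
Qed.
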